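(* Let $k\ge 12$ be an even integer and let $p\in W_k^-$. Define coefficients $c_{r,s}\in\mathbb{Q}$ (for integers $r,s\ge 1$ with $r+s=k-1$) by $$\frac{\partial}{\partial X}\,p(X+Y,Y)=\sum_{r+s=k-1}\binom{k-3}{r-1}\,c_{r,s}\,X^{r-1}Y^{s-1}.$$ Then in the formal double zeta space $\mathcal{D}_{k-1}$ one has $$\sum_{\substack{r+s=k-1\\ 4\le r\le k-4,\ r\text{ even}}}(c_{r,s}-c_{s,r})\,Z_{r,s}\equiv 0 \pmod{Z_{k-1}},$$ i.e. the left-hand side is a rational multiple of $Z_{k-1}$ in $\mathcal{D}_{k-1}$.
   Context: Formal double zeta space. For an integer $w>2$, $\mathcal{D}_w$ is the $\mathbb{Q}$-vector space generated by formal symbols $Z_{r,s}$, $P_{r,s}$ (for integers $r,s\ge 1$ with $r+s=w$) and $Z_w$, modulo the relations $$Z_{r,s}+Z_{s,r}=P_{r,s}-Z_w\quad (r+s=w,\ r,s\ge1),$$ $$\sum_{\substack{r+s=w\\ r,s\ge 1}}\left[\binom{r-1}{i-1}+\binom{r-1}{j-1}\right]Z_{r,s}=P_{i,j}\quad (i+j=w,\ i,j\ge1).$$ Period polynomials. For even $k$, $V_k$ is the $\mathbb{Q}$-vector space of homogeneous polynomials of degree $k-2$ in $X,Y$ with rational coefficients, and $W_k\subset V_k$ is the subspace of polynomials $P$ satisfying $P(X,Y)+P(-Y,X)=0$ and $P(X,Y)+P(X-Y,X)+P(Y,Y-X)=0$. Then $W_k=W_k^+\oplus W_k^-$, where $W_k^+$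 (resp. $W_k^-$) is the subspace of polynomials that are symmetric, $P(X,Y)=P(Y,X)$ (resp. antisymmetric, $P(X,Y)=-P(Y,X)$). *)

(* Defs.v *)
From HB Require Import structures.
From mathcomp Require Import all_boot all_order all_algebra.
From mathcomp Require Import generic_quotient ring_quotient mpoly.

Set Implicit Arguments.
Unset Strict Implicit.
Unset Printing Implicit Defensive.

Import GRing.Theory.
Local Open Scope ring_scope.
Local Open Scope quotient_scope.

(* Quotient.quot is the quotient of a zmodType by a subgroup; scaling descends
   to it when the subgroup is a subspace U of V, giving the space V / U. *)
Section QuotientSpace.
Variables (K : fieldType) (V : vectType K) (U : {vspace V}).

Definition quotv : Type := Quotient.quot U.

HB.instance Definition _ := GRing.Zmodule.on quotv.
HB.instance Definition _ := Quotient.on quotv.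

Definition projv_quot (v : V) : quotv := \pi_quotv v.

Lemma projv_quotP (u v : V) : projv_quot u = projv_quot v <-> u - v \in U.
Proof.
have -> : (u - v \in U) = (projv_quot u == projv_quot v).
  exact: Quotient.idealrBE.
by split=> [e | /eqP//]; apply/eqP.
Qed.

Lemma projv_quotD (u v : V) :
  projv_quot (u + v) = projv_quot u + projv_quot v.
Proof. exact: (Quotient.pi_add _ u v). Qed.

Lemma projv_quotK (x : quotv) : projv_quot (repr x) = x.
Proof. exact: reprK. Qed.

Definition scaleq (a : K) (x : quotv) : quotv := projv_quot (a *: repr x).

Lemma projv_quotZ a v : projv_quot (a *: v) = scaleq a (projv_quot v).
Proof.
apply/projv_quotP; rewrite -scalerBr memvZ //.
by apply/projv_quotP; rewrite projv_quotK.
Qed.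

Lemma scaleqA a b x : scaleq a (scaleq b x) = scaleq (a * b) x.
Proof. by rewrite -(projv_quotK x) -!projv_quotZ scalerA. Qed.

Lemma scale1q : left_id 1 scaleq.
Proof. by move=> x; rewrite -(projv_quotK x) -projv_quotZ scale1r. Qed.

Lemma scaleqDr : right_distributive scaleq +%R.
Proof.
move=> a x y; rewrite -(projv_quotK x) -(projv_quotK y).
by rewrite -projv_quotD -!projv_quotZ -projv_quotD scalerDr.
Qed.

Lemma scaleqDl x : {morph scaleq^~ x : a b / a + b}.
Proof.
move=> a b; rewrite -(projv_quotK x).
by rewrite -!projv_quotZ -projv_quotD scalerDl.
Qed.

HB.instance Definition _ := GRing.Zmodule_isLmodule.Build K quotv
  scaleqA scale1q scaleqDr scaleqDl.

Lemma projv_quot_is_linear : linear projv_quot.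
Proof. by move=> a u v; rewrite projv_quotD projv_quotZ. Qed.

HB.instance Definition _ := GRing.isLinear.Build K V quotv *:%R projv_quot
  projv_quot_is_linear.

End QuotientSpace.

Section FormalDoubleZeta.
Variable w : nat.

Definition is_pospair (rs : 'I_w.+1 * 'I_w.+1) : bool :=
  [&& 0 < rs.1, 0 < rs.2 & rs.1 + rs.2 == w]%N.
Definition pospair : Type := {rs | is_pospair rs}.
HB.instance Definition _ := SubFinite.on pospair.

Definition pfst (rs : pospair) : nat := (val rs).1.
Definition psnd (rs : pospair) : nat := (val rs).2.

Fact pswap_subproof (rs : pospair) : is_pospair ((val rs).2, (val rs).1).
Proof.
by case: rs => -[r s] /= /and3P[r0 s0 e]; rewrite /is_pospair r0 s0 addnC e.
Qed.

Definition pswap (rs : pospair) : pospair :=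
  exist is_pospair _ (pswap_subproof rs).

(* The generators: inl (inl (r, s)) is Z_{r,s}, inl (inr (r, s)) is P_{r,s},
   and inr tt is Z_w. *)
Definition dzgen : Type := (pospair + pospair + unit)%type.
HB.instance Definition _ := Finite.on dzgen.

Definition dzfree : Type := {ffun dzgen -> rat^o}.
HB.instance Definition _ := Vector.on dzfree.

Definition dzbasis (g : dzgen) : dzfree := [ffun h => (h == g)%:R].
Definition genZ (rs : pospair) : dzfree := dzbasis (inl (inl rs)).
Definition genP (rs : pospair) : dzfree := dzbasis (inl (inr rs)).
Definition genZw : dzfree := dzbasis (inr tt).

Definition stuffle_rel (rs : pospair) : dzfree :=
  genZ rs + genZ (pswap rs) - (genP rs - genZw).

Definition shuffle_rel (ij : pospair) : dzfree :=
  \sum_(rs : pospair)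
    ('C((pfst rs).-1, (pfst ij).-1) + 'C((pfst rs).-1, (psnd ij).-1))%:R
      *: genZ rs
  - genP ij.

Definition dzrel : {vspace dzfree} :=
  <<[seq stuffle_rel rs | rs : pospair]
    ++ [seq shuffle_rel ij | ij : pospair]>>%VS.

Definition dzspace : Type := quotv dzrel.
HB.instance Definition _ := GRing.Lmodule.on dzspace.

Definition dzZ (rs : pospair) : dzspace := projv_quot dzrel (genZ rs).
Definition dzP (rs : pospair) : dzspace := projv_quot dzrel (genP rs).
Definition dzZw : dzspace := projv_quot dzrel genZw.

Lemma dz_rel_eq0 (x : dzfree) :
  x \in [seq stuffle_rel rs | rs : pospair]
        ++ [seq shuffle_rel ij | ij : pospair] ->
  projv_quot dzrel x = 0.
Proof.
move=> x_rel; rewrite -(linear0 (projv_quot dzrel)); apply/projv_quotP.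
by rewrite subr0; apply: memv_span.
Qed.

Lemma dz_stuffle (rs : pospair) : dzZ rs + dzZ (pswap rs) = dzP rs - dzZw.
Proof.
apply/eqP; rewrite -subr_eq0.
have <- : projv_quot dzrel (stuffle_rel rs) =
          dzZ rs + dzZ (pswap rs) - (dzP rs - dzZw).
  rewrite /stuffle_rel linearB linearD.
  by rewrite (linearB (projv_quot dzrel) (genP rs)).
by apply/eqP/dz_rel_eq0; rewrite mem_cat image_f.
Qed.

Lemma dz_shuffle (ij : pospair) :
  \sum_(rs : pospair)
    ('C((pfst rs).-1, (pfst ij).-1) + 'C((pfst rs).-1, (psnd ij).-1))%:R
      *: dzZ rs
  = dzP ij.
Proof.
apply/eqP; rewrite -subr_eq0.
have := @dz_rel_eq0 (shuffle_rel ij).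
rewrite mem_cat [X in _ || X]image_f // orbT => /(_ isT).
rewrite /shuffle_rel linearB linear_sum.
by under eq_bigr => rs _ do rewrite linearZ; move=> ->.
Qed.

End FormalDoubleZeta.

Definition polX : {mpoly rat[2]} := 'X_(ord0 : 'I_2).
Definition polY : {mpoly rat[2]} := 'X_(ord_max : 'I_2).

Definition subst2 (p a b : {mpoly rat[2]}) : {mpoly rat[2]} :=
  p \mPo [tuple a; b].

Definition dX (p : {mpoly rat[2]}) : {mpoly rat[2]} := p^`M(ord0 : 'I_2).

Definition Vper (k : nat) : {pred {mpoly rat[2]}} :=
  [pred p | p \is (k - 2).-homog].

Definition Wper (k : nat) : {pred {mpoly rat[2]}} :=
  [pred p | [&& p \in Vper k,
    p + subst2 p (- polY) polX == 0 &
    p + subst2 p (polX - polY) polX + subst2 p polY (polY - polX) == 0]].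

Definition Wper_plus (k : nat) : {pred {mpoly rat[2]}} :=
  [pred p | (p \in Wper k) && (p == subst2 p polY polX)].

Definition Wper_minus (k : nat) : {pred {mpoly rat[2]}} :=
  [pred p | (p \in Wper k) && (p == - subst2 p polY polX)].

(* Main.v *)
(* Put f = dp/dX; it is odd in X and even in Y, and antisymmetry turns dp/dY
   into -f(Y,X), so differentiating the three-term relation gives
     f(X,Y) - f(X,X-Y) = f(X-Y,Y) - f(X-Y,X).                             (1)
   Encode coefficients a_{r,s} by sum binom(w-2,r-1) a_{r,s} X^(r-1) Y^(s-1),
   so that c becomes f(X+Y,Y).  For symmetric H the shuffle and stuffle
   relations say that H(X+Y,X) - H(X,Y) encodes a combination of the Z_{r,s}
   which is a multiple of Z_w.  By (1) the choice
     H = (f(X-Y,X) - f(X-Y,Y)) / 2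
   is symmetric and H(X+Y,X) - H(X,Y) is the part of f(X+Y,Y) - f(X+Y,X) odd in
   X, i.e. the combination of (c_{r,s} - c_{s,r}) Z_{r,s} over all even r.  Its
   boundary coefficients r = 2 and r = w-1 vanish, again by (1). *)
Require Import Defs.
From mathcomp Require Import all_boot all_order all_algebra.
From mathcomp Require Import mpoly.
From mathcomp Require Import ring zify.

Set Implicit Arguments.
Unset Strict Implicit.
Unset Printing Implicit Defensive.

Import GRing.Theory Num.Theory.
Local Open Scope ring_scope.

Local Notation poly2 := {mpoly rat[2]}.

(** * Substitution into bivariate polynomials and the chain rule *)

Section Substitution.
Implicit Types p q a b : poly2.

Definition dY p : poly2 := p^`M(ord_max : 'I_2).

(** Constants, X and Y generate the ring, so an identity compatible with sums and products need only
    be checked on them. *)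
Lemma poly2_ind (P : poly2 -> Prop) :
  (forall c, P c%:MP) -> P polX -> P polY ->
  (forall p q, P p -> P q -> P (p + q)) ->
  (forall p q, P p -> P q -> P (p * q)) ->
  forall p, P p.
Proof.
move=> PC PX PY PD PM; have PXn x i : P x -> P (x ^+ i).
  move=> Px; elim: i => [|i IH]; first by rewrite expr0 -mpolyC1; apply: PC.
  by rewrite exprS; apply/PM.
elim/mpolyind => [|c m p _ _ Pp]; first by rewrite -mpolyC0; apply: PC.
apply: PD => //; rewrite -mul_mpolyC; apply: (PM); first exact: PC.
rewrite mpolyXE_id big_ord_recl big_ord1.
apply: PM; apply: PXn => //.
Qed.

Lemma subst2D p q a b : subst2 (p + q) a b = subst2 p a b + subst2 q a b.
Proof. exact: comp_mpolyD. Qed.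

Lemma subst2N p a b : subst2 (- p) a b = - subst2 p a b.
Proof. exact: comp_mpolyN. Qed.

Lemma subst2M p q a b : subst2 (p * q) a b = subst2 p a b * subst2 q a b.
Proof. exact: rmorphM. Qed.

Lemma subst2Mn p i a b : subst2 (p *+ i) a b = subst2 p a b *+ i.
Proof. exact: comp_mpolyMn. Qed.

Lemma subst2Xn p i a b : subst2 (p ^+ i) a b = subst2 p a b ^+ i.
Proof. exact: rmorphXn. Qed.

Lemma subst2C c a b : subst2 c%:MP a b = c%:MP.
Proof. exact: comp_mpolyC. Qed.

Lemma subst2Z c p a b : subst2 (c *: p) a b = c *: subst2 p a b.
Proof. exact: comp_mpolyZ. Qed.

Lemma subst2_sum (I : finType) (F : I -> poly2) a b :
  subst2 (\sum_i F i) a b = \sum_i subst2 (F i) a b.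
Proof. exact: raddf_sum. Qed.

Lemma subst2X a b : subst2 polX a b = a.
Proof. exact: comp_mpolyXU. Qed.

Lemma subst2Y a b : subst2 polY a b = b.
Proof. exact: comp_mpolyXU. Qed.

Lemma subst20 a b : subst2 0 a b = 0.
Proof. exact: comp_mpoly0. Qed.

Lemma subst21 a b : subst2 1 a b = 1.
Proof. exact: comp_mpoly1. Qed.

Definition subst2E := (subst2D, subst2N, subst2M, subst2Xn, subst2C, subst20,
  subst21, subst2X, subst2Y).

Lemma subst2_comp p a b u v :
  subst2 (subst2 p a b) u v = subst2 p (subst2 a u v) (subst2 b u v).
Proof.
elim/poly2_ind: p => [c|||p q Hp Hq|p q Hp Hq].
- by rewrite !subst2C.
- by rewrite !subst2X.
- by rewrite !subst2Y.
- by rewrite !subst2D Hp Hq.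
by rewrite !subst2M Hp Hq.
Qed.

Lemma mderivXU i j : ('X_i : poly2)^`M(j) = (i == j)%:R.
Proof.
rewrite mderivX mnm1E; have [->|_] := eqVneq i j; last by rewrite scale0r.
by rewrite scale1r -[X in (X - _)%MM]add0m addmK mpolyX0.
Qed.

Lemma dX_polX : dX polX = 1. Proof. exact: mderivXU. Qed.
Lemma dX_polY : dX polY = 0. Proof. exact: mderivXU. Qed.
Lemma dY_polX : dY polX = 0. Proof. exact: mderivXU. Qed.
Lemma dY_polY : dY polY = 1. Proof. exact: mderivXU. Qed.

Lemma dXD p q : dX (p + q) = dX p + dX q. Proof. exact: mderivD. Qed.
Lemma dXN p : dX (- p) = - dX p. Proof. exact: mderivN. Qed.
Lemma dXZ c p : dX (c *: p) = c *: dX p. Proof. exact: mderivZ. Qed.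
Lemma dXM p q : dX (p * q) = dX p * q + p * dX q.
Proof. exact: mderivM. Qed.

Definition dXE := (dXD, dXN, dX_polX, dX_polY).

Lemma dYD p q : dY (p + q) = dY p + dY q. Proof. exact: mderivD. Qed.
Lemma dYM p q : dY (p * q) = dY p * q + p * dY q.
Proof. exact: mderivM. Qed.

Lemma dX_subst2 p a b :
  dX (subst2 p a b) = subst2 (dX p) a b * dX a + subst2 (dY p) a b * dX b.
Proof.
elim/poly2_ind: p => [c|||p q Hp Hq|p q Hp Hq].
- by rewrite subst2C /dX /dY !mderivC !subst20 !mul0r addr0.
- by rewrite dX_polX dY_polX subst2X subst20 subst21 mul0r mul1r addr0.
- by rewrite dX_polY dY_polY subst2Y subst20 subst21 mul0r mul1r add0r.
- by rewrite subst2D !dXD dYD Hp Hq !subst2D !mulrDl addrACA.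
rewrite subst2M !dXM dYM Hp Hq !subst2D !subst2M !mulrDl !mulrDr addrACA.
by rewrite -!mulrA ![_ * subst2 q a b]mulrC.
Qed.

(** * Parity of f = dp/dX and its three-term relation *)

Section Antisymmetric.
Variable p : poly2.
Hypothesis p_anti : p = - subst2 p polY polX.

Lemma subst2_antisym a b : subst2 p a b = - subst2 p b a.
Proof. by rewrite {1}p_anti subst2N subst2_comp !subst2E. Qed.

Lemma dY_antisym a b : subst2 (dY p) a b = - subst2 (dX p) b a.
Proof.
have {2}-> : p = - subst2 p polY polX by [].
rewrite dXN dX_subst2 !dXE mulr0 mulr1 add0r subst2N opprK.
by rewrite subst2_comp !subst2E.
Qed.

Hypothesis p_rot : p + subst2 p (- polY) polX = 0.

(** Rotation gives p(a,b) = -p(-b,a), and antisymmetry turns the right side into p(a,-b). *)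
Lemma subst2_even2 a b : subst2 p a (- b) = subst2 p a b.
Proof.
have /(congr1 (fun x => subst2 x a b)) := p_rot.
rewrite subst2D subst2_comp !subst2E.
by rewrite (subst2_antisym (- b)) => /subr0_eq.
Qed.

Lemma subst2_even1 a b : subst2 p (- a) b = subst2 p a b.
Proof. by rewrite subst2_antisym subst2_even2 -subst2_antisym. Qed.

Lemma dX_even2 a b : subst2 (dX p) a (- b) = subst2 (dX p) a b.
Proof.
have /(congr1 (fun q => subst2 (dX q) a b)) := subst2_even2 polX polY.
rewrite !dX_subst2 !dXE !(mulr1, oppr0, mulr0, addr0).
by rewrite !subst2_comp !subst2E.
Qed.

Lemma dX_odd1 a b : subst2 (dX p) (- a) b = - subst2 (dX p) a b.
Proof.
have /(congr1 (fun q => subst2 (dX q) a b)) := subst2_even1 polX polY.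
rewrite !dX_subst2 !dXE !(mulrN1, mulr1, mulr0, addr0).
by rewrite subst2N !subst2_comp !subst2E => <-; rewrite opprK.
Qed.

Hypothesis p_period :
  p + subst2 p (polX - polY) polX + subst2 p polY (polY - polX) = 0.

(** This is (1): the derivatives of p(X-Y,X) and p(Y,Y-X) involve dp/dY, which [dY_antisym] converts
    to f; oddness then replaces Y-X by X-Y. *)
Lemma dX_period a b :
  subst2 (dX p) a b - subst2 (dX p) a (a - b)
  = subst2 (dX p) (a - b) b - subst2 (dX p) (a - b) a.
Proof.
have /(congr1 (fun q => subst2 (dX q) a b)) := p_period.
rewrite !dXD !dX_subst2 !dXE !subst2E !subst2_comp !dY_antisym !subst2E.
have -> : dX 0 = 0 by rewrite /dX mderiv0.
rewrite subst20 !mulr1 subr0 mulr0 add0r sub0r mulrN1 mulr1 opprK.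
have -> : b - a = - (a - b) by rewrite opprB.
rewrite dX_odd1 => e; apply/subr0_eq; rewrite -{}e.
by rewrite opprB -!addrA; congr (_ + _); rewrite addrCA; congr (_ + _); rewrite addrC.
Qed.

End Antisymmetric.

End Substitution.

(** * Polynomials with binomially weighted coefficients *)

Lemma bin_multinomial t u b :
  ('C(t + u + b, u + b) * 'C(u + b, b) = 'C(t + u + b, t + u) * 'C(t + u, t))%N.
Proof.
have b1 : ('C(t + u + b, u + b) * ((u + b)`! * t`!) = (t + u + b)`!)%N.
  by have := bin_fact (leq_addl t (u + b)); rewrite addnK addnA.
have b2 : ('C(u + b, b) * (b`! * u`!) = (u + b)`!)%N.
  by have := bin_fact (leq_addl u b); rewrite addnK.
have b3 : ('C(t + u + b, t + u) * ((t + u)`! * b`!) = (t + u + b)`!)%N.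
  by have := bin_fact (leq_addr b (t + u)); rewrite addKn.
have b4 : ('C(t + u, t) * (t`! * u`!) = (t + u)`!)%N.
  by have := bin_fact (leq_addr u t); rewrite addKn.
(* Both sides are the trinomial coefficient: multiplied by t! u! b! they become (t+u+b)!. *)
have f0 : (0 < t`! * u`! * b`!)%N by rewrite !muln_gt0 !fact_gt0.
apply/eqP; rewrite -(eqn_pmul2r f0); apply/eqP.
transitivity (t + u + b)`!; first by rewrite -b1 -b2; ring.
by rewrite -b3 -b4; ring.
Qed.

Section PosPair.
Variable n : nat.
Local Notation w := n.+2.
Implicit Types rs ij : pospair w.

Lemma pospairP rs :
  [/\ (0 < pfst rs)%N, (0 < psnd rs)%N & (pfst rs + psnd rs = w)%N].
Proof. by case/and3P: (valP rs) => ? ? /eqP. Qed.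

Lemma pred_pospair rs : ((pfst rs).-1 + (psnd rs).-1)%N = n.
Proof. by case: (pospairP rs); lia. Qed.

Lemma pfst_inj : injective (@pfst w).
Proof.
move=> rs ij e; have e2 : psnd rs = psnd ij.
  by case: (pospairP rs) (pospairP ij) => _ _ + [_ _]; lia.
apply: val_inj; rewrite [LHS]surjective_pairing [RHS]surjective_pairing.
by congr pair; apply: val_inj.
Qed.

Lemma pswapK : involutive (@pswap w).
Proof. by move=> [[r s] rs]; apply: val_inj. Qed.

Fact pospair_of_subproof (t : 'I_n.+1) :
  is_pospair (inord (n - t).+1 : 'I_w.+1, inord t.+1 : 'I_w.+1).
Proof. by rewrite /is_pospair /= !inordK; have := ltn_ord t; lia. Qed.

(** Numbering the pairs by t = s-1 gives exponents (n-t, t), the order of terms in the binomial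
    theorem. *)
Definition pospair_of (t : 'I_n.+1) : pospair w :=
  exist (@is_pospair w) _ (pospair_of_subproof t).

Lemma pfst_pospair_of t : pfst (pospair_of t) = (n - t).+1.
Proof. by rewrite /pfst /= inordK //; have := ltn_ord t; lia. Qed.

Lemma psnd_pospair_of t : psnd (pospair_of t) = t.+1.
Proof. by rewrite /psnd /= inordK //; have := ltn_ord t; lia. Qed.

Lemma sum_pospair (V : nmodType) (F : nat -> nat -> V) :
  \sum_(rs : pospair w) F (pfst rs).-1 (psnd rs).-1
  = \sum_(t < n.+1) F (n - t)%N t.
Proof.
rewrite (reindex pospair_of) /=.
  by apply: eq_bigr => t _; rewrite pfst_pospair_of psnd_pospair_of.
exists (fun rs => inord (psnd rs).-1) => [t | rs] _.
  by apply/val_inj; rewrite psnd_pospair_of /= inordK.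
case: (pospairP rs) => r0 s0 e; apply/pfst_inj.
by rewrite pfst_pospair_of inordK; lia.
Qed.

(** With these weights, the substitution (X+Y, X) acts on coefficients through the binomials of the
    shuffle relations. *)
Definition binpoly (a : pospair w -> rat) : poly2 :=
  \sum_(rs : pospair w) ('C(n, (pfst rs).-1)%:R * a rs)
     *: (polX ^+ (pfst rs).-1 * polY ^+ (psnd rs).-1).

Lemma eq_binpoly a b : a =1 b -> binpoly a = binpoly b.
Proof. by move=> e; apply: eq_bigr => rs _; rewrite e. Qed.

Lemma binpolyD a b : binpoly (fun rs => a rs + b rs) = binpoly a + binpoly b.
Proof. by rewrite -big_split; apply: eq_bigr => rs _; rewrite mulrDr scalerDl. Qed.

Lemma binpolyZ x a : binpoly (fun rs => x * a rs) = x *: binpoly a.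
Proof. by rewrite scaler_sumr; apply: eq_bigr => rs _; rewrite mulrCA scalerA. Qed.

Lemma binpolyN a : binpoly (fun rs => - a rs) = - binpoly a.
Proof. by rewrite -scaleN1r -binpolyZ; apply: eq_binpoly => rs; rewrite mulN1r. Qed.

Lemma subst2_binpoly h a b :
  subst2 (binpoly h) a b = \sum_(rs : pospair w) ('C(n, (pfst rs).-1)%:R * h rs)
     *: (a ^+ (pfst rs).-1 * b ^+ (psnd rs).-1).
Proof. by rewrite subst2_sum; apply: eq_bigr => rs _; rewrite subst2Z !subst2E. Qed.

Lemma bin_pswap rs : 'C(n, (psnd rs).-1) = 'C(n, (pfst rs).-1).
Proof.
have e := pred_pospair rs; rewrite -(@bin_sub n (pfst rs).-1); last by lia.
by congr 'C(_, _); lia.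
Qed.

Lemma binpoly_pswap h : binpoly (h \o @pswap w) = subst2 (binpoly h) polY polX.
Proof.
rewrite subst2_binpoly (reindex_inj (inv_inj pswapK)); apply: eq_bigr => rs _ /=.
by rewrite bin_pswap [X in _ *: X]mulrC.
Qed.

Lemma binpoly_signl h :
  binpoly (fun rs => (-1) ^+ (pfst rs).-1 * h rs) = subst2 (binpoly h) (- polX) polY.
Proof.
rewrite subst2_binpoly; apply: eq_bigr => rs _.
rewrite [in RHS]exprNn -[in LHS]signr_odd -[in RHS]signr_odd !mulr_sign.
by case: odd; rewrite ?(mulrN, mulNr, scaleNr, scalerN).
Qed.

Lemma binpoly_signr h :
  binpoly (fun rs => (-1) ^+ (psnd rs).-1 * h rs) = subst2 (binpoly h) polX (- polY).
Proof.
rewrite subst2_binpoly; apply: eq_bigr => rs _.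
rewrite [in RHS]exprNn -[in LHS]signr_odd -[in RHS]signr_odd !mulr_sign.
by case: odd; rewrite ?(mulrN, mulNr, scaleNr, scalerN).
Qed.

(* Half the left-hand side of the shuffle relations weighted by a symmetric h. *)
Definition shift_coef (h : pospair w -> rat) rs : rat :=
  \sum_(ij : pospair w) 'C((pfst rs).-1, (psnd ij).-1)%:R * h ij.

Lemma binpoly_shift_coef h :
  binpoly (shift_coef h) = subst2 (binpoly h) (polX + polY) polX.
Proof.
rewrite subst2_binpoly /binpoly.
under eq_bigr => rs _ do rewrite /shift_coef mulr_sumr scaler_suml.
rewrite exchange_big; apply: eq_bigr => ij _ /=.
have := pred_pospair ij; move: (pfst ij).-1 (psnd ij).-1 => a b e.
pose F r s : poly2 := ('C(n, r)%:R * ('C(r, b)%:R * h ij)) *: (polX ^+ r * polY ^+ s).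
rewrite (sum_pospair F) /F exprDn mulr_suml scaler_sumr.
rewrite (big_ord_widen n.+1 (fun t => ('C(n, a)%:R * h ij) *:
  (polX ^+ (a - t) * polY ^+ t *+ 'C(a, t) * polX ^+ b))); last by lia.
rewrite [RHS]big_mkcond; apply: eq_bigr => t _ /=; have lt_tn := ltn_ord t.
case: ltnP => [le_ta | lt_at]; last first.
  (* For t > a the exponent n-t is below b, so 'C(n-t, b) vanishes and the widened terms match. *)
  by rewrite [X in X%:R * h ij]bin_small ?mul0r ?mulr0 ?scale0r //; lia.
have -> : polX ^+ (n - t) = polX ^+ (a - t) * polX ^+ b.
  by rewrite -exprD; congr (_ ^+ _); lia.
rewrite [X in _ = _ *: X]mulrnAl -[X in _ = _ *: X](@scaler_nat rat) scalerA.
rewrite [in LHS]mulrAC; congr (_ *: _).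
rewrite mulrA -natrM mulrAC -natrM; congr (_%:R * _).
(* Since a+b = n, the trinomial identity reads C(n,n-t) C(n-t,b) = C(n,a) C(a,t). *)
have := bin_multinomial t (a - t) b; rewrite subnKC // e => <-.
by congr ('C(n, _) * 'C(_, b))%N; lia.
Qed.

Lemma mcoeff_binpoly h rs :
  (binpoly h)@_(U_(ord0) *+ (pfst rs).-1 + U_(ord_max) *+ (psnd rs).-1)
  = 'C(n, (pfst rs).-1)%:R * h rs.
Proof.
rewrite raddf_sum (bigD1 rs) //= big1 ?addr0 => [|ij ne].
  by rewrite mcoeffZ /polX /polY !mpolyXn -mpolyXD mcoeffX eqxx mulr1.
rewrite mcoeffZ /polX /polY !mpolyXn -mpolyXD mcoeffX.
have [|_] := eqVneq; last by rewrite mulr0.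
move/mnmP/(_ ord0); rewrite !mnmDE !mulmnE !mnm1E /= => e.
case/eqP: ne; apply: pfst_inj.
by case: (pospairP rs) (pospairP ij) e => ? _ _ [? _ _]; lia.
Qed.

(** The binomial weights are nonzero rationals and distinct pairs carry distinct monomials. *)
Lemma binpoly_inj a b : binpoly a = binpoly b -> a =1 b.
Proof.
move=> e rs; have := mcoeff_binpoly a rs; rewrite e mcoeff_binpoly => /esym.
apply: mulfI; rewrite pnatr_eq0 -lt0n bin_gt0.
by have := pred_pospair rs; lia.
Qed.

(** * Double zeta relations weighted by a symmetric family *)

Section Relation.
Variables (V : lmodType rat) (Z P : pospair w -> V) (Zw : V).
Hypothesis stuffle : forall rs, Z rs + Z (pswap rs) = P rs - Zw.
Hypothesis shuffle : forall ij, \sum_(rs : pospair w)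
  ('C((pfst rs).-1, (pfst ij).-1) + 'C((pfst rs).-1, (psnd ij).-1))%:R *: Z rs
  = P ij.

(** Evaluate the sum of h_{i,j} P_{i,j} once by stuffle and once by shuffle; both values contain a
    doubled sum of Z's, and halving their difference leaves the multiple of [Zw]. *)
Lemma shift_coef_relation h : (forall rs, h (pswap rs) = h rs) ->
  \sum_(rs : pospair w) (shift_coef h rs - h rs) *: Z rs
    = (2^-1 * \sum_(rs : pospair w) h rs) *: Zw.
Proof.
move=> h_sym.
have sumP : \sum_ij h ij *: P ij
    = 2%:R *: (\sum_ij h ij *: Z ij) + (\sum_ij h ij) *: Zw.
  transitivity (\sum_ij (h ij *: Z ij + h ij *: Z (pswap ij) + h ij *: Zw)).
    by apply: eq_bigr => ij _; rewrite -!scalerDr stuffle subrK.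
  rewrite !big_split /= -scaler_suml; congr (_ + _).
  rewrite [X in _ + X](reindex_inj (inv_inj pswapK)) /= scaler_nat mulr2n.
  by congr (_ + _); apply: eq_bigr => ij _; rewrite h_sym pswapK.
have sumS : \sum_ij h ij *: P ij = 2%:R *: \sum_rs shift_coef h rs *: Z rs.
  transitivity (\sum_ij \sum_rs (h ij *
      ('C((pfst rs).-1, (pfst ij).-1) + 'C((pfst rs).-1, (psnd ij).-1))%:R) *: Z rs).
    apply: eq_bigr => ij _; rewrite -shuffle scaler_sumr.
    by apply: eq_bigr => rs _; rewrite scalerA.
  rewrite exchange_big scaler_sumr; apply: eq_bigr => rs _ /=.
  rewrite -scaler_suml scalerA; congr (_ *: _).
  (* Symmetry of h makes the two binomial sums equal, whence the factor 2. *)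
  rewrite mulr_natl mulr2n; under eq_bigr => ij _ do rewrite natrD mulrDr.
  rewrite big_split /= (reindex_inj (inv_inj pswapK)) /=.
  by congr (_ + _); apply: eq_bigr => ij _; rewrite ?h_sym mulrC.
under eq_bigr => rs _ do rewrite scalerBl.
rewrite sumrB -scalerA -(@scalerK _ _ 2%:R _ (_ - _)) //; congr (_ *: _).
by rewrite scalerBr -sumS sumP addrC addKr.
Qed.
End Relation.
End PosPair.

(** * Reading off the boundary coefficients by evaluation *)

Lemma subst2_binpoly10 n (a : pospair n.+2 -> rat) rs :
  psnd rs = 1%N -> subst2 (binpoly a) 1 0 = (a rs)%:MP.
Proof.
move=> s1; have r1 : (pfst rs).-1 = n by have := pred_pospair rs; rewrite s1; lia.
rewrite subst2_binpoly (bigD1 rs) //= big1 ?addr0 => [|ij ne].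
  by rewrite s1 expr1n expr0 mulr1 r1 binn mul1r -mul_mpolyC mulr1.
rewrite [0 ^+ _]expr0n; case: eqP => [s0|_]; last by rewrite mulr0 scaler0.
by case/eqP: ne; apply: pfst_inj;
  case: (pospairP rs) (pospairP ij) => _ _ ? [_ ? ?]; lia.
Qed.

Lemma dX_polXn i : dX (polX ^+ i) = polX ^+ i.-1 *+ i.
Proof.
case: i => [|i]; first by rewrite expr0 /dX -mpolyC1 mderivC mulr0n.
elim: i => [|i IH]; first by rewrite expr1 dX_polX.
by rewrite exprS dXM dX_polX mul1r IH /= mulrnAr -exprS -mulrS.
Qed.

Lemma dX_polYn i : dX (polY ^+ i) = 0.
Proof.
elim: i => [|i IH]; first by rewrite expr0 /dX -mpolyC1 mderivC.
by rewrite exprS dXM dX_polY IH mul0r mulr0 addr0.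
Qed.

(** At (0,1) the X-derivative keeps only the term linear in X, whose weight is C(n,1) = n. *)
Lemma subst2_dX_binpoly01 n (a : pospair n.+2 -> rat) rs :
  pfst rs = 2 -> subst2 (dX (binpoly a)) 0 1 = (n%:R * a rs)%:MP.
Proof.
move=> r2; rewrite /dX /binpoly raddf_sum -/dX subst2_sum (bigD1 rs) //=.
rewrite big1 ?addr0 => [|ij ne].
  rewrite mderivZ -/(dX _) dXM dX_polXn dX_polYn r2 mulr0 addr0 expr0 mul1r.
  by rewrite subst2Z subst2Xn subst2Y expr1n bin1 -mul_mpolyC mulr1.
rewrite mderivZ -/(dX _) dXM dX_polXn dX_polYn mulr0 addr0.
rewrite subst2Z subst2M subst2Mn subst2Xn subst2X.
rewrite [0 ^+ _]expr0n; case: eqP => [r0|_]; last by rewrite mul0rn mul0r scaler0.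
(* Truncated predecessors leave [pfst ij] equal to 1 or 2; 2 is excluded by [ne], and for 1
   differentiation contributes the factor 0. *)
case: (pospairP ij) => i0 _ _; have r1 : (pfst ij).-1 = 0%N.
  by apply: contra_neq_eq ne => ?; apply: pfst_inj; lia.
by rewrite r1 mulr0n mul0r scaler0.
Qed.

(** * The even-r part of c and the symmetric H attached to p *)

Section PeriodPolynomial.
Variable p : poly2.
Hypothesis p_anti : p = - subst2 p polY polX.
Hypothesis p_rot : p + subst2 p (- polY) polX = 0.
Hypothesis p_period :
  p + subst2 p (polX - polY) polX + subst2 p polY (polY - polX) = 0.

Local Notation f := (subst2 (dX p)).

Let odd1 := dX_odd1 p_anti p_rot.
Let even2 := dX_even2 p_anti p_rot.
Let period := dX_period p_anti p_rot p_period.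

Lemma dX_period_plus a b : f a b - f a (a + b) = f (a + b) b - f (a + b) a.
Proof. by have := period a (- b); rewrite opprK !even2. Qed.

Lemma dX_sub0 b : f 0 b = 0.
Proof.
have := odd1 0 b; rewrite oppr0 => /eqP; rewrite -addr_eq0 -mulr2n => /eqP e.
by rewrite -[LHS](scalerK (a := 2%:R : rat)) // scaler_nat e scaler0.
Qed.

(* Twice the part of f(X+Y,Y) - f(X+Y,X) that is odd in X. *)
Definition evenD : poly2 :=
  f (polX + polY) polY - f (polX + polY) polX
  + (f (polX - polY) polY - f (polX - polY) polX).

(** The value is 2(f(1,0) - f(1,1)), and (1) at (1,1) gives f(1,0) = f(1,1). *)
Lemma evenD10 : subst2 evenD 1 0 = 0.
Proof.
have := period 1 1; rewrite subrr => e.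
rewrite !subst2D !subst2N !subst2_comp !subst2E oppr0 addr0.
have : f 1 0 = f 1 1.
  by apply/esym/subr0_eq; rewrite e subrr.
by move=> ->; rewrite subrr addr0.
Qed.

(** By (1), [evenD] equals 2f(X,Y) - f(X,X+Y) - f(X,X-Y). At (0,1) its X-derivative vanishes because
    df/dX is even in Y and f(0,Y) = 0 forces df/dY = 0 on X = 0. *)
Lemma dX_evenD01 : subst2 (dX evenD) 0 1 = 0.
Proof.
rewrite /evenD -dX_period_plus -period.
have fx b : subst2 (dX (dX p)) 0 (- b) = subst2 (dX (dX p)) 0 b.
  have /(congr1 (fun q => subst2 (dX q) 0 b)) := even2 polX polY.
  rewrite !dX_subst2 !dXE oppr0 !mulr0 !addr0 !mulr1.
  by rewrite !subst2_comp !subst2E.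
have fy b : subst2 (dY (dX p)) 0 b = 0.
  have /(congr1 (fun q => subst2 (dX q) b 0)) := dX_sub0 polX.
  have dX0 : dX 0 = 0 by rewrite /dX mderiv0.
  rewrite dX_subst2 dX0 dX_polX mulr0 add0r mulr1.
  by rewrite subst2_comp !subst2E.
rewrite !dXD !dXN !dX_subst2 !dXE oppr0 !mulr0 !addr0 !mulr1.
rewrite !subst2D !subst2N !subst2D !subst2_comp !subst2E.
by rewrite !add0r !fy fx !addr0 subrr addr0.
Qed.

Variables (n : nat) (c : pospair n.+2 -> rat).
Hypothesis binpoly_c : binpoly c = f (polX + polY) polY.

Definition even_diff (rs : pospair n.+2) : rat :=
  (~~ odd (pfst rs))%:R * (c rs - c (pswap rs)).

(* Encodes H = (f(X-Y,X) - f(X-Y,Y)) / 2. *)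
Definition half_sym (rs : pospair n.+2) : rat :=
  - 2^-1 * ((-1) ^+ (psnd rs).-1 * c rs + (-1) ^+ (pfst rs).-1 * c (pswap rs)).

Lemma binpoly_even_diff : binpoly even_diff = 2^-1 *: evenD.
Proof.
(* The indicator of even r is (1 - (-1)^(r-1))/2, and the sign amounts to X -> -X. *)
have -> : binpoly even_diff = binpoly (fun rs => 2^-1 *
    (c rs + - (c \o @pswap _) rs
     + - ((-1) ^+ (pfst rs).-1 * (c rs + - (c \o @pswap _) rs)))).
  apply: eq_binpoly => rs; rewrite /even_diff /=.
  case: (pospairP rs) => r0 _ _; rewrite -signr_odd -[in LHS](prednK r0) /= negbK.
  by case: odd => /=; field.
rewrite binpolyZ binpolyD binpolyN binpoly_signl !binpolyD binpolyN.
rewrite binpoly_pswap binpoly_c subst2D subst2N !subst2_comp !subst2E; congr (_ *: _).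
rewrite /evenD opprD opprK [polY + polX]addrC.
rewrite [- polX + polY]addrC -!(opprB polX polY).
by rewrite !odd1 even2 opprK.
Qed.

Lemma half_sym_pswap rs : half_sym (pswap rs) = half_sym rs.
Proof. by rewrite /half_sym pswapK addrC. Qed.

Lemma binpoly_half_sym :
  binpoly half_sym = - 2^-1 *: (f (polX - polY) polY - f (polX - polY) polX).
Proof.
rewrite binpolyZ binpolyD binpoly_signr (binpoly_signl (c \o @pswap _)).
rewrite binpoly_pswap binpoly_c !subst2_comp !subst2E; congr (_ *: _).
by rewrite -(opprB polX polY) !even2 odd1.
Qed.

(** Compare encodings: (1) in its plus form at (Y,X) turns H(X+Y,X) into (f(X+Y,Y) - f(X+Y,X))/2,
    the first half of [evenD]/2; -H is the other half. *)
Lemma shift_half_sym rs : shift_coef half_sym rs - half_sym rs = even_diff rs.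
Proof.
suff /binpoly_inj/(_ rs) : binpoly (fun rs => shift_coef half_sym rs - half_sym rs)
    = binpoly even_diff by [].
rewrite binpolyD binpolyN binpoly_shift_coef binpoly_even_diff binpoly_half_sym.
rewrite subst2Z subst2D subst2N !subst2_comp !subst2E -scalerBr scaleNr -scalerN.
congr (_ *: _); rewrite /evenD.
have -> : polX + polY - polX = polY by rewrite addrC addKr.
by rewrite [polX + polY]addrC dX_period_plus opprB [RHS]addrC opprB.
Qed.

Lemma even_diff_psnd1 rs : psnd rs = 1%N -> even_diff rs = 0.
Proof.
move=> s1; have /esym/eqP := subst2_binpoly10 even_diff s1.
by rewrite binpoly_even_diff subst2Z evenD10 scaler0 mpolyC_eq0 => /eqP.
Qed.

Lemma even_diff_pfst2 rs : pfst rs = 2 -> even_diff rs = 0.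
Proof.
move=> r2; have /esym/eqP := subst2_dX_binpoly01 even_diff r2.
rewrite binpoly_even_diff dXZ subst2Z dX_evenD01 scaler0 mpolyC_eq0.
rewrite mulf_eq0 pnatr_eq0 => /orP[/eqP n0|/eqP //].
(* If n = 0 the weight is 2, so [pfst rs] = 2 would leave [psnd rs] = 0. *)
by case: (pospairP rs) => _; lia.
Qed.
End PeriodPolynomial.

Theorem theorem3 (k : nat) (hk : (12 <= k)%N) (k_even : ~~ odd k)
    (p : {mpoly rat[2]}) (hp : p \in Wper_minus k)
    (c : pospair (k - 1) -> rat)
    (hc : dX (subst2 p (polX + polY) polY) =
      \sum_(rs : pospair (k - 1))
        ('C(k - 3, (pfst rs).-1)%:R * c rs)
          *: (polX ^+ (pfst rs).-1 * polY ^+ (psnd rs).-1)) :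
  exists q : rat,
    \sum_(rs : pospair (k - 1)
           | [&& (4 <= pfst rs)%N, (pfst rs <= k - 4)%N & ~~ odd (pfst rs)])
      (c rs - c (pswap rs)) *: dzZ rs
    = q *: dzZw (k - 1) :> dzspace (k - 1).
Proof.
case/andP: hp => /and3P[_ /eqP p_rot /eqP p_period] /eqP p_anti.
(* With k = n+3 the weight k-1 is n+2 and the binomial index k-3 is n, as in [binpoly]. *)
case: k hk k_even c hc => [|[|[|n]]] // n12 n_odd.
rewrite [(n.+3 - 1)%N]subn1 /= => c.
rewrite [(n.+3 - 3)%N]subn0 -/(binpoly c) dX_subst2 !dXE addr0 mulr1 mulr0 addr0.
(* The witness is the factor of [Zw] in [shift_coef_relation] for H. *)
move=> /esym hc; exists (2^-1 * \sum_rs half_sym c rs).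
rewrite -(shift_coef_relation (@dz_stuffle n.+2) (@dz_shuffle n.+2)); last first.
  exact: half_sym_pswap.
rewrite big_mkcond; apply: eq_bigr => rs _.
rewrite (shift_half_sym p_anti p_rot p_period hc).
case: ifP => [/and3P[_ _ ev]|out]; first by rewrite /even_diff ev mul1r.
have [ev|od] := boolP (~~ odd (pfst rs)); last first.
  by rewrite /even_diff (negbTE od) mul0r scale0r.
have [r2|r2] := eqVneq (pfst rs) 2.
  by rewrite (even_diff_pfst2 p_anti p_rot p_period hc r2) scale0r.
(* An even r > k-4 is k-2, because k-3 is odd and r is at most k-2; hence s = 1. *)
rewrite (even_diff_psnd1 p_anti p_rot p_period hc) ?scale0r //.
by move: out; rewrite ev andbT; case: (pospairP rs); lia.
Qed.
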